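(* Suppose the system is locally $1$-step reachable: there exists $\gamma>0$ such that for every $x\in\mathcal{X}_\gamma:=\{x\in\mathcal{X}:\|x-x_F\|\le\gamma\}$ there exists $u_x^{\mathrm{one}}\in\mathcal{U}$ with $f(x,u_x^{\mathrm{one}})=x_F$. Let the stage cost be $r(x,u)=r_x(x)+r_u(u)$, where $r_x,r_u$ are continuous functions satisfying $r_x(x_F)=0$, $r_x(x)>0$ for all $x\in\mathcal{X}\setminus\{x_F\}$, $r_u(0)=0$, and $r_u(u)>0$ for all $u\in\mathcal{U}\setminus\{0\}$. Assume that there exist $c>0$ and $\alpha_1,\alpha_2,\alpha_3,C_1,C_2,C_3\ge0$ such that (i) $\|f(x,u_1)-f(x,u_2)\|\ge C_1\|u_1-u_2\|^{\alpha_1}$ for all $u_1,u_2\in\mathcal{U}$ and for all $x\in\mathcal{X}_c$, where $\mathcal{X}_c:=\{x\in\mathcal{X}:\|x-x_F\|\le c\}$; (ii) $|r_u(u_1)-r_u(u_2)|\le C_2\|u_1-u_2\|^{\alpha_2}$ for all $u_1,u_2\in\mathcal{U}$; (iii) $r_x(x)\ge C_3\|x-x_F\|^{\alpha_3}$ for all $x\in\mathcal{X}$. Assume that either of the following holds: (a) $\alpha_1\alpha_3=\alpha_2$ and $C_3C_1^{\alpha_3}\ge C_2$; or (b) $\alpha_1\alpha_3<\alpha_2$ and $\mathrm{diam}(\mathcal{U})\le\left(\frac{C_3C_1^{\alpha_3}}{C_2}\right)^{\frac{1}{\alpha_2-\alpha_1\alpha_3}}$. Then $\mathcal{X}_c\subseteq\mathcal{Q}$,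 where $$\mathcal{Q}:=\{x\in\mathcal{X}_\gamma:\ \exists\, u_x^{\mathrm{one}}\in\mathcal{U}\text{ such that } f(x,u_x^{\mathrm{one}})=x_F\text{ and } r_x(f(x,u))+r_u(u)\ge r_u(u_x^{\mathrm{one}})\ \ \forall u\in\mathcal{U}\}.$$
   Context: $f:\mathbb{R}^{n_x}\times\mathbb{R}^{n_u}\to\mathbb{R}^{n_x}$ defines the discrete-time system $x_{t+1}=f(x_t,u_t)$; $\mathcal{X}\subset\mathbb{R}^{n_x}$ and $\mathcal{U}\subset\mathbb{R}^{n_u}$ are compact constraint sets for the state and the input; $x_F\in\mathcal{X}$ is the target equilibrium point (the system stays at $x_F$ under zero input). $r:\mathcal{X}\times\mathcal{U}\to[0,\infty)$ is the stage cost. $\|\cdot\|$ is the Euclidean norm and $\mathrm{diam}(\mathcal{U})=\max_{u_1,u_2\in\mathcal{U}}\|u_1-u_2\|$ is the diameter of $\mathcal{U}$.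
   Formalization: The inclusion X_c ⊆ X_γ (e.g. c ≤ γ) is assumed, as the claim fails without it; in Q the inequality is required only for u in U with f(x,u) in X, where r_x(f(x,u)) is defined; in (b) the bound on diam(U) is dropped if C_2 = 0. *)

(* Defs.v *)
From HB Require Import structures.
From mathcomp Require Import all_boot all_order all_algebra.
From mathcomp Require Import all_classical all_reals all_analysis.
Set Implicit Arguments.
Unset Strict Implicit.
Unset Printing Implicit Defensive.
Import Order.TTheory GRing.Theory Num.Theory.
Import numFieldNormedType.Exports.
Local Open Scope classical_set_scope.
Local Open Scope ring_scope.

(* The library norm `|x| on 'cV[R]_n is the sup norm, so the Euclidean norm
   has to be defined.  Both induce the same topology, hence [compact] and
   [continuous] keep their usual meaning. *)
Definition enorm (R : realType) (n : nat) (x : 'cV[R]_n) : R :=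
  Num.sqrt (\sum_(i < n) x i 0 ^+ 2).

(* For U compact and nonempty this supremum is the maximum of |u1 - u2|. *)
Definition diam (R : realType) (n : nat) (U : set 'cV[R]_n) : R :=
  sup [set d | exists u1 u2, [/\ U u1, U u2 & d = enorm (u1 - u2)]].

Definition near_target (R : realType) (n : nat) (X : set 'cV[R]_n)
    (xF : 'cV[R]_n) (rho : R) : set 'cV[R]_n :=
  [set x | X x /\ enorm (x - xF) <= rho].

(* [rx] is a total function, but only its values on X are meaningful: the
   stage cost lives on X x U.  Accordingly the inequality is required for the
   inputs u whose successor state f x u lies in X, i.e. where [rx (f x u)] is
   defined.  When f maps X x U into X the guard disappears, see
   [optimal_one_step_invariant]. *)
Definition optimal_one_step (R : realType) (nx nu : nat)
    (f : 'cV[R]_nx -> 'cV[R]_nu -> 'cV[R]_nx)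
    (X : set 'cV[R]_nx) (U : set 'cV[R]_nu) (xF : 'cV[R]_nx)
    (rx : 'cV[R]_nx -> R) (ru : 'cV[R]_nu -> R) (gamma : R) :
    set 'cV[R]_nx :=
  [set x | near_target X xF gamma x /\
     exists uone, [/\ U uone, f x uone = xF &
       forall u, U u -> X (f x u) -> rx (f x u) + ru u >= ru uone]].

Lemma optimal_one_step_invariant (R : realType) (nx nu : nat)
    (f : 'cV[R]_nx -> 'cV[R]_nu -> 'cV[R]_nx)
    (X : set 'cV[R]_nx) (U : set 'cV[R]_nu) (xF : 'cV[R]_nx)
    (rx : 'cV[R]_nx -> R) (ru : 'cV[R]_nu -> R) (gamma : R) :
  (forall x u, X x -> U u -> X (f x u)) ->
  optimal_one_step f X U xF rx ru gamma =
  [set x | near_target X xF gamma x /\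
     exists uone, [/\ U uone, f x uone = xF &
       forall u, U u -> rx (f x u) + ru u >= ru uone]].
Proof.
move=> fX; apply/seteqP; split=> x [[Xx dx] [v [Uv fv h]]];
  split=> //; exists v; split=> // u Uu.
  by apply: h => //; exact: fX.
by move=> _; exact: h.
Qed.

(* Main.v *)
Require Import Defs.
From HB Require Import structures.
From mathcomp Require Import all_boot all_order all_algebra.
From mathcomp Require Import all_classical all_reals all_analysis.
Import Order.TTheory GRing.Theory Num.Theory.
Import numFieldNormedType.Exports.
Local Open Scope classical_set_scope.
Local Open Scope ring_scope.

(** Let x lie within c of the target, let v be an input steering x to xF in one
    step, and let u be a competing input at distance d = enorm (u - v).  By
    [ru_holder], switching from v to u saves at most C2 d^alpha2 of input cost;
    on the other hand the successor f x u misses xF = f x v by at least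
    C1 d^alpha1, so that it pays at least C3 C1^alpha3 d^(alpha1 alpha3) of
    state cost.  The theorem thus reduces to the scalar inequality
    C2 d^alpha2 <= C3 C1^alpha3 d^(alpha1 alpha3), which is [scaled_powR_le]:
    either the exponents agree and the coefficients are compared, or the
    saving has the larger exponent and is dominated as long as d stays below
    the crossing point of the two power functions.  Since U is bounded,
    d <= diam U ([enorm_le_diam]), and the hypothesis on diam U is precisely
    that d cannot pass this crossing point.

    The case d = 0 has to be kept apart, because 0 `^ 0 = 1: there u = v and
    both sides of the optimality inequality coincide. *)

Lemma enorm_gt0 {R : realType} {n : nat} (x : 'cV[R]_n) :
  x != 0 -> 0 < enorm x.
Proof.
move=> x0; rewrite sqrtr_gt0 lt0r sumr_ge0 ?andbT; last first.
  by move=> i _; exact: sqr_ge0.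
apply: contra x0 => /eqP s0; apply/eqP/matrixP => i j.
rewrite (ord1 j) mxE; apply/eqP; rewrite -sqrf_eq0; apply/eqP.
by apply: (psumr_eq0P _ s0) => // k _; exact: sqr_ge0.
Qed.

Lemma coord_le_norm {R : realType} {n : nat} (x : 'cV[R]_n) (i : 'I_n) :
  `|x i 0| <= `|x|.
Proof.
change `|x| with (mx_norm x); rewrite mx_normrE.
exact: (le_bigmax _ (fun ij : 'I_n * 'I_1 => `|x ij.1 ij.2|) (i, 0)).
Qed.

Lemma enorm_le_norm {R : realType} {n : nat} (x : 'cV[R]_n) (M : R) :
  `|x| <= M -> enorm x <= Num.sqrt (\sum_(i < n) M ^+ 2).
Proof.
move=> xM; have M0 := le_trans (normr_ge0 x) xM.
rewrite ler_wsqrtr //; apply: ler_sum => i _.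
rewrite -real_normK ?num_real // ler_sqr ?nnegrE //.
exact: le_trans (coord_le_norm x i) xM.
Qed.

(** As [sup] is 0 on a set without upper bound, the distances in U must first be
    shown to be bounded: U is bounded for the sup norm, which controls the
    Euclidean one. *)
Lemma enorm_le_diam {R : realType} {n : nat} {U : set 'cV[R]_n}
    {u v : 'cV[R]_n} :
  bounded_set U -> U u -> U v -> enorm (u - v) <= diam U.
Proof.
move=> /ex_strict_bound_gt0[M _ UM] Uu Uv.
apply: ub_le_sup; last by exists u, v.
exists (Num.sqrt (\sum_(i < n) (M + M) ^+ 2)) => _ [a [b [Ua Ub ->]]].
apply: enorm_le_norm; apply: le_trans (ler_normB a b) _.
by apply: lerD; apply: ltW; exact: UM.
Qed.

(** When a < b and 0 < C, dividing by C d^a turns the claim into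
    d^(b - a) <= K / C, so that the bound on d is where both sides cross. *)
Lemma scaled_powR_le {R : realType} (C K a b d : R) :
  0 <= C -> 0 <= K -> 0 < d ->
  (a = b /\ C <= K) \/ (a < b /\ (0 < C -> d <= (K / C) `^ (1 / (b - a)))) ->
  C * d `^ b <= K * d `^ a.
Proof.
move=> C0 K0 d0 [[-> CK]|[ab dK]].
  by rewrite ler_wpM2r ?powR_ge0.
have [C_eq0|C_neq0] := eqVneq C 0.
  by rewrite C_eq0 mul0r mulr_ge0 ?powR_ge0.
have Cgt0 : 0 < C by rewrite lt0r C_neq0.
have ba0 : 0 < b - a by rewrite subr_gt0.
have KC0 : 0 <= K / C by rewrite divr_ge0.
have dba : d `^ (b - a) <= K / C.
  rewrite -[leRHS](powRr1 KC0) -[1](mulVf (lt0r_neq0 ba0)) powRrM -[(b - a)^-1]div1r.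
  by rewrite ge0_ler_powR ?nnegrE ?powR_ge0 ?(ltW ba0) ?(ltW d0) ?dK.
rewrite -(subrK a b) powRD ?(lt0r_neq0 d0) ?implybT // mulrA.
by rewrite ler_wpM2r ?powR_ge0 // mulrC -ler_pdivlMr.
Qed.

(** A lower bound on the displacement e is turned into a lower bound on the
    state cost; the product of the exponents comes from composing the two
    power functions. *)
Lemma powR_growth_comp {R : realType} {C1 C3 a1 a3 d e : R} :
  0 <= C1 -> 0 <= C3 -> 0 <= a3 -> C1 * d `^ a1 <= e ->
  C3 * C1 `^ a3 * d `^ (a1 * a3) <= C3 * e `^ a3.
Proof.
move=> C10 C30 a30 le_e; rewrite -mulrA ler_wpM2l //.
rewrite powRrM -powRM ?powR_ge0 //.
have e0 : 0 <= C1 * d `^ a1 by rewrite mulr_ge0 ?powR_ge0.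
by apply: ge0_ler_powR => //; rewrite nnegrE //; exact: le_trans le_e.
Qed.

Theorem mainTheorem6 (R : realType) (nx nu : nat)
    (f : 'cV[R]_nx -> 'cV[R]_nu -> 'cV[R]_nx)
    (X : set 'cV[R]_nx) (U : set 'cV[R]_nu) (xF : 'cV[R]_nx)
    (X_compact : compact X) (U_compact : compact U)
    (xF_X : X xF) (xF_equilibrium : f xF 0 = xF)
    (gamma : R) (gamma_gt0 : 0 < gamma)
    (one_step_reachable : forall x, near_target X xF gamma x ->
       exists2 uone, U uone & f x uone = xF)
    (r : 'cV[R]_nx -> 'cV[R]_nu -> R)
    (rx : 'cV[R]_nx -> R) (ru : 'cV[R]_nu -> R)
    (r_ge0 : forall x u, X x -> U u -> 0 <= r x u)
    (r_split : forall x u, X x -> U u -> r x u = rx x + ru u)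
    (rx_continuous : {within X, continuous rx})
    (ru_continuous : {within U, continuous ru})
    (rx_xF : rx xF = 0) (rx_gt0 : forall x, X x -> x <> xF -> 0 < rx x)
    (ru_0 : ru 0 = 0) (ru_gt0 : forall u, U u -> u <> 0 -> 0 < ru u)
    (c : R) (c_gt0 : 0 < c)
    (* The conclusion itself entails this inclusion; it holds if c <= gamma. *)
    (Xc_sub_Xgamma : near_target X xF c `<=` near_target X xF gamma)
    (alpha1 alpha2 alpha3 C1 C2 C3 : R)
    (alpha1_ge0 : 0 <= alpha1) (alpha2_ge0 : 0 <= alpha2)
    (alpha3_ge0 : 0 <= alpha3)
    (C1_ge0 : 0 <= C1) (C2_ge0 : 0 <= C2) (C3_ge0 : 0 <= C3)
    (f_lower : forall u1 u2, U u1 -> U u2 ->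
       forall x, near_target X xF c x ->
       enorm (f x u1 - f x u2) >= C1 * enorm (u1 - u2) `^ alpha1)
    (ru_holder : forall u1 u2, U u1 -> U u2 ->
       `|ru u1 - ru u2| <= C2 * enorm (u1 - u2) `^ alpha2)
    (rx_lower : forall x, X x -> rx x >= C3 * enorm (x - xF) `^ alpha3)
    (* In the second case the quotient by C2 is read as +oo when C2 = 0. *)
    (cases :
       (alpha1 * alpha3 = alpha2 /\ C3 * C1 `^ alpha3 >= C2) \/
       (alpha1 * alpha3 < alpha2 /\
        (0 < C2 -> diam U <=
           (C3 * C1 `^ alpha3 / C2) `^ (1 / (alpha2 - alpha1 * alpha3))))) :
  near_target X xF c `<=` optimal_one_step f X U xF rx ru gamma.
Proof.
move=> x Xc_x; have Xg_x := Xc_sub_Xgamma _ Xc_x.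
split=> //; have [v Uv fxv] := one_step_reachable _ Xg_x.
exists v; split=> // u Uu X_fxu.
have [->|uv] := eqVneq u v; first by rewrite fxv rx_xF add0r.
have d0 : 0 < enorm (u - v) by rewrite enorm_gt0 // subr_eq0.
have d_diam := enorm_le_diam (compact_bounded U_compact) Uu Uv.
have saving : ru v - ru u <= C2 * enorm (u - v) `^ alpha2.
  by apply: le_trans (ru_holder _ _ Uu Uv); rewrite distrC ler_norm.
have miss : C1 * enorm (u - v) `^ alpha1 <= enorm (f x u - xF).
  by rewrite -fxv; exact: f_lower.
rewrite -lerBlDr; apply: le_trans saving _.
apply: le_trans (rx_lower _ X_fxu).
apply: le_trans (powR_growth_comp C1_ge0 C3_ge0 alpha3_ge0 miss).
apply: scaled_powR_le => //; first by rewrite mulr_ge0 ?powR_ge0.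
case: cases => [|[lt_exp le_diam]]; [by left | right; split=> // C2_gt0].
exact: le_trans d_diam (le_diam C2_gt0).
Qed.
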